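(* BigTwoDisjointSets $\le_{ql}$ ZerosMatrixMultiplication.
   Context: Quasilinear reductions: for an instance $I$ let $s(I)$ be its size. A quasilinear Karp reduction from problem $\mathcal P$ to problem $\mathcal Q$ (written $\mathcal P\le_{ql}\mathcal Q$) is a function $\Phi$ from instances of $\mathcal P$ to instances of $\mathcal Q$ such that for every instance $I$ of $\mathcal P$: $\Phi(I)$ can be computed in time $\tilde O(s(I))$ (that is, $O(s(I)\log^j s(I))$ for a fixed $j$), and $I$ and $\Phi(I)$ have the same output. BigTwoDisjointSets: input is a finite set $X$ and a collection $\mathcal C$ of subsets of $X$ with $|X|<\log^{c}(|\mathcal C|)$ for a fixed constant $c$ (sets represented as lists); output True if there are two disjoint sets $C,C'\in\mathcal C$, False otherwise. ZerosMatrixMultiplication: input is two $0$-$1$ matrices $M,M'$ stored as adjacency lists (only positions of nonzero entries are stored); output True if the product $MM'$ contains an entry equal to $0$, False otherwise. *)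

(* Defs.v *)
From HB Require Import structures.
From mathcomp Require Import all_boot all_order all_algebra.
From mathcomp Require Import reals exp.

Set Implicit Arguments.
Unset Strict Implicit.
Unset Printing Implicit Defensive.

Import Order.TTheory GRing.Theory Num.Theory.

(* Logarithmic-cost random access machine in the style of Cook and Reckhow,
   over nat with truncated subtraction.  Registers and memory are the same
   array: [Fetch] and [Store] are the indirect accesses.  A program halts when
   the program counter leaves it. *)
Module RAM.

Inductive instr : Type :=
| Const (d n : nat)
| Add (d a b : nat)
| Sub (d a b : nat)
| Fetch (d a : nat)
| Store (a b : nat)
| Read (d : nat)
| Print (a : nat)
| Jpos (a l : nat).

Definition program : Type := seq instr.

Record config : Type := Config {
  pc : nat;
  mem : nat -> nat;
  inp : seq nat;
  out : seq nat
}.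

Definition init (w : seq nat) : config := Config 0 (fun _ => 0) w [::].

Definition upd (m : nat -> nat) (a v : nat) : nat -> nat :=
  fun x => if x == a then v else m x.

Definition step (i : instr) (s : config) : config :=
  let: Config k m w o := s in
  match i with
  | Const d n => Config k.+1 (upd m d n) w o
  | Add d a b => Config k.+1 (upd m d (m a + m b)) w o
  | Sub d a b => Config k.+1 (upd m d (m a - m b)) w o
  | Fetch d a => Config k.+1 (upd m d (m (m a))) w o
  | Store a b => Config k.+1 (upd m (m a) (m b)) w o
  | Read d => Config k.+1 (upd m d (head 0 w)) (behead w) o
  | Print a => Config k.+1 m w (rcons o (m a))
  | Jpos a l => Config (if 0 < m a then l else k.+1) m w o
  end.

Definition bitlen (n : nat) : nat := (trunc_log 2 n).+1.

(* The addresses written in the instructions are constants of the program, so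
   only the data handled and the addresses computed at run time are charged. *)
Definition cost (i : instr) (s : config) : nat :=
  let m := mem s in
  match i with
  | Const _ _ => 1
  | Add _ a b => bitlen (m a) + bitlen (m b)
  | Sub _ a b => bitlen (m a) + bitlen (m b)
  | Fetch _ a => bitlen (m a) + bitlen (m (m a))
  | Store a b => bitlen (m a) + bitlen (m b)
  | Read _ => bitlen (head 0 (inp s))
  | Print a => bitlen (m a)
  | Jpos a _ => bitlen (m a)
  end.

Inductive exec (P : program) : config -> nat -> seq nat -> Prop :=
| ExecHalt s : onth P (pc s) = None -> exec P s 0 (out s)
| ExecStep s i t o : onth P (pc s) = Some i ->
    exec P (step i s) t o -> exec P s (cost i s + t) o.

Definition computes_within (P : program) (w o : seq nat) (b : nat) : Prop :=
  exists2 t, t <= b & exec P (init w) t o.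

End RAM.

Record problem : Type := Problem {
  instance : Type;
  inst_size : instance -> nat;
  encode : instance -> seq nat;
  output : instance -> bool
}.

Definition quasilinear (T : nat -> nat) : Prop :=
  exists j K N : nat, forall n, N <= n -> T n <= K * (n * trunc_log 2 n ^ j).

Definition ql_reduction (P Q : problem) (Phi : instance P -> instance Q) : Prop :=
  (exists (prog : RAM.program) (T : nat -> nat), quasilinear T /\
     forall I : instance P,
       RAM.computes_within prog (encode I) (encode (Phi I)) (T (inst_size I)))
  /\ (forall I : instance P, output I = output (Phi I)).

Definition ql_reducible (P Q : problem) : Prop :=
  exists Phi : instance P -> instance Q, ql_reduction Phi.

Notation "P '<=_ql' Q" := (ql_reducible P Q) (at level 70, no associativity).

(* Each list is preceded by its length, so that the encoding is uniquely
   decodable once the number of lists is known. *)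
Definition encode_lists (n : nat) (L : seq (seq 'I_n)) : seq nat :=
  flatten [seq size l :: [seq val x | x <- l] | l <- L].

Definition total_size (T : Type) (L : seq (seq T)) : nat :=
  sumn [seq size l | l <- L].

Section BigTwoDisjointSets.
Local Open Scope ring_scope.
Variables (R : realType) (c : R).

Definition log2 (x : R) : R := ln x / ln 2.

(* X is {0, ..., btds_card - 1}; the collection and its members are sets given
   as duplicate-free lists (up to the order of the elements, for members). *)
Record btds_instance : Type := BTDSInstance {
  btds_card : nat;
  btds_lists : seq (seq 'I_btds_card);
  btds_lists_uniq : all uniq btds_lists;
  btds_sets_uniq : uniq [seq [set x in C] | C <- btds_lists];
  btds_big : btds_card%:R < log2 (size btds_lists)%:R `^ c
}.

Definition btds_collection (I : btds_instance) : {set {set 'I_(btds_card I)}} :=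
  [set A in [seq [set x in C] | C <- btds_lists I]].

Definition btds_size (I : btds_instance) : nat :=
  (btds_card I + size (btds_lists I) + total_size (btds_lists I))%N.

Definition btds_encode (I : btds_instance) : seq nat :=
  btds_card I :: size (btds_lists I) :: encode_lists (btds_lists I).

Definition btds_output (I : btds_instance) : bool :=
  [exists C in btds_collection I, exists C' in btds_collection I,
     (C != C') && [disjoint C & C']].

Definition BigTwoDisjointSets : problem :=
  Problem btds_size btds_encode btds_output.

End BigTwoDisjointSets.

Section ZerosMatrixMultiplication.
Local Open Scope ring_scope.

(* Row i is the list of the columns j with a nonzero entry at (i, j). *)
Record adj_matrix (p q : nat) : Type := AdjMatrix {
  adj_rows : p.-tuple (seq 'I_q);
  adj_rows_uniq : all uniq adj_rows
}.

Definition mx_of_adj (p q : nat) (A : adj_matrix p q) : 'M[int]_(p, q) :=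
  \matrix_(i, j) (j \in tnth (adj_rows A) i)%:R.

Record zmm_instance : Type := ZMMInstance {
  zmm_p : nat;
  zmm_q : nat;
  zmm_r : nat;
  zmm_left : adj_matrix zmm_p zmm_q;
  zmm_right : adj_matrix zmm_q zmm_r
}.

Definition zmm_size (I : zmm_instance) : nat :=
  (zmm_p I + zmm_q I + zmm_r I + total_size (adj_rows (zmm_left I))
   + total_size (adj_rows (zmm_right I)))%N.

Definition zmm_encode (I : zmm_instance) : seq nat :=
  [:: zmm_p I, zmm_q I, zmm_r I
    & encode_lists (adj_rows (zmm_left I))
      ++ encode_lists (adj_rows (zmm_right I))].

Definition zmm_output (I : zmm_instance) : bool :=
  [exists i, exists j,
     (mx_of_adj (zmm_left I) *m mx_of_adj (zmm_right I)) i j == 0].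

Definition ZerosMatrixMultiplication : problem :=
  Problem zmm_size zmm_encode zmm_output.

End ZerosMatrixMultiplication.

(* Main.v *)
Require Import Defs.
From mathcomp Require Import all_boot all_order all_algebra.
From mathcomp Require Import reals exp.
From mathcomp Require Import zify.

(** The rows of M are the sets of the collection and M' is the transpose of M,
    so the (i, j) entry of M M' is the number of common elements of the i-th and
    j-th sets, which vanishes iff they are disjoint.  The diagonal entries only
    matter when the empty set is in the collection, and this is harmless as soon
    as there is a second set.  Since |X| is polylogarithmic, M' can be printed
    row by row, scanning all incidences once per element of X. *)

Set Implicit Arguments.
Unset Strict Implicit.
Unset Printing Implicit Defensive.

Import Order.TTheory GRing.Theory Num.Theory.
Import RAM.

(** * Logarithmic cost from a step count and a bound on the operands *)

Definition small (V : nat) (i : instr) (s : config) : bool :=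
  let m := mem s in
  match i with
  | Const _ _ => true
  | Add _ a b => (m a <= V) && (m b <= V)
  | Sub _ a b => (m a <= V) && (m b <= V)
  | Fetch _ a => (m a <= V) && (m (m a) <= V)
  | Store a b => (m a <= V) && (m b <= V)
  | Read _ => head 0 (inp s) <= V
  | Print a => m a <= V
  | Jpos a _ => m a <= V
  end.

Lemma leq_bitlen m n : m <= n -> bitlen m <= bitlen n.
Proof. by move=> le_mn; rewrite ltnS leq_trunc_log. Qed.

(** An instruction other than [Const] is charged for one or two quantities, and [small] bounds
    exactly these. *)
Lemma small_cost V i s : small V i s -> cost i s <= 2 * bitlen V.
Proof.
have lt0 : 0 < bitlen V by [].
by case: i => [d n|d a b|d a b|d a|a b|d|a|a l] /=; first lia;
  try (case/andP=> /leq_bitlen ? /leq_bitlen ?; lia);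
  move=> /leq_bitlen ?; lia.
Qed.

(* [n] bounds the number of steps, [V] the operands of each of them. *)
Inductive halts (P : program) (V : nat) : config -> nat -> seq nat -> Prop :=
| HaltsEnd s n : onth P (pc s) = None -> halts P V s n (out s)
| HaltsStep s i n o : onth P (pc s) = Some i -> small V i s ->
    halts P V (step i s) n o -> halts P V s n.+1 o.

(** [HaltsEnd] accepts any [n], so step counts are upper bounds and can be rounded up to one value
    per loop iteration. *)
Lemma halts_leq P V s n n' o : n <= n' -> halts P V s n o -> halts P V s n' o.
Proof.
move=> le_nn' H; elim: H n' le_nn' => {s n o} [s n Ps|s i n o Ps sm _ IH] [|n'] //.
- by move=> _; apply: HaltsEnd.
- by move=> _; apply: HaltsEnd.
- by rewrite ltnS => /IH; apply: HaltsStep Ps sm.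
Qed.

Lemma halts_exec P V s n o : halts P V s n o ->
  exists2 t, t <= n * (2 * bitlen V) & exec P s t o.
Proof.
elim=> {s n o} [s n Ps|s i n o Ps /small_cost sm _ [t le_t Ht]].
  by exists 0; last exact: ExecHalt.
exists (cost i s + t); last exact: ExecStep Ps Ht.
by rewrite mulSn leq_add.
Qed.

(** * Memory layout and program *)

Local Notation rOne := 0 (only parsing).
Local Notation rCard := 1 (only parsing).
Local Notation rSize := 2 (only parsing).
Local Notation rI := 3 (only parsing).
Local Notation rX := 4 (only parsing).
Local Notation rTop := 5 (only parsing).
Local Notation rLen := 6 (only parsing).
Local Notation rPtr := 7 (only parsing).
Local Notation rCnt := 8 (only parsing).
Local Notation rY := 9 (only parsing).
Local Notation rZ := 10 (only parsing).
Local Notation rTmp := 11 (only parsing).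
Local Notation rTmp' := 12 (only parsing).
Local Notation rZero := 13 (only parsing).
Local Notation base := 16 (only parsing).

(* The pairs (y, i) with y in the i-th set are stored consecutively from cell
   [base] on while the lists are copied to the output; then, for each x, the
   pairs are scanned twice, to count and to print the i paired with x.  If X is
   empty the empty matrices are printed: for c = 0 the collection may then be
   {set0}, a False instance on which M M' would have a zero entry. *)
Definition transpose_prog : program := [::
  (*  0 *) Const rOne 1;
  (*  1 *) Read rCard;
  (*  2 *) Read rSize;
  (*  3 *) Jpos rCard 8;
  (*  4 *) Print rZero;
  (*  5 *) Print rZero;
  (*  6 *) Print rZero;
  (*  7 *) Jpos rOne 62;
  (*  8 *) Print rSize;
  (*  9 *) Print rCard;
  (* 10 *) Print rSize;
  (* 11 *) Const rTop base;
  (* 12 *) Sub rTmp rSize rI;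
  (* 13 *) Jpos rTmp 15;
  (* 14 *) Jpos rOne 28;
  (* 15 *) Read rLen;
  (* 16 *) Print rLen;
  (* 17 *) Jpos rLen 20;
  (* 18 *) Add rI rI rOne;
  (* 19 *) Jpos rOne 12;
  (* 20 *) Read rY;
  (* 21 *) Print rY;
  (* 22 *) Store rTop rY;
  (* 23 *) Add rTop rTop rOne;
  (* 24 *) Store rTop rI;
  (* 25 *) Add rTop rTop rOne;
  (* 26 *) Sub rLen rLen rOne;
  (* 27 *) Jpos rOne 17;
  (* 28 *) Sub rTmp rCard rX;
  (* 29 *) Jpos rTmp 31;
  (* 30 *) Jpos rOne 62;
  (* 31 *) Const rCnt 0;
  (* 32 *) Const rPtr base;
  (* 33 *) Sub rTmp rTop rPtr;
  (* 34 *) Jpos rTmp 36;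
  (* 35 *) Jpos rOne 45;
  (* 36 *) Fetch rY rPtr;
  (* 37 *) Add rPtr rPtr rOne;
  (* 38 *) Add rPtr rPtr rOne;
  (* 39 *) Sub rTmp rY rX;
  (* 40 *) Sub rTmp' rX rY;
  (* 41 *) Add rTmp rTmp rTmp';
  (* 42 *) Jpos rTmp 33;
  (* 43 *) Add rCnt rCnt rOne;
  (* 44 *) Jpos rOne 33;
  (* 45 *) Print rCnt;
  (* 46 *) Const rPtr base;
  (* 47 *) Sub rTmp rTop rPtr;
  (* 48 *) Jpos rTmp 50;
  (* 49 *) Jpos rOne 60;
  (* 50 *) Fetch rY rPtr;
  (* 51 *) Add rPtr rPtr rOne;
  (* 52 *) Fetch rZ rPtr;
  (* 53 *) Add rPtr rPtr rOne;
  (* 54 *) Sub rTmp rY rX;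
  (* 55 *) Sub rTmp' rX rY;
  (* 56 *) Add rTmp rTmp rTmp';
  (* 57 *) Jpos rTmp 47;
  (* 58 *) Print rZ;
  (* 59 *) Jpos rOne 47;
  (* 60 *) Add rX rX rOne;
  (* 61 *) Jpos rOne 28].

(** * Correctness and step count of the program *)

Fixpoint stored (m : nat -> nat) (a : nat) (A : seq (nat * nat)) : Prop :=
  if A is pr :: A' then [/\ m a = pr.1, m a.+1 = pr.2 & stored m a.+2 A']
  else True.

Lemma eq_stored m m' a A : (forall k, a <= k < a + 2 * size A -> m' k = m k) ->
  stored m a A -> stored m' a A.
Proof.
elim: A a => //= pr A IH a eqm [ma ma1 st].
rewrite !eqm; try lia; split=> //.
by apply: IH st => k ?; apply: eqm; lia.
Qed.

Lemma stored_rcons m a A pr : stored m a A ->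
  m (a + 2 * size A) = pr.1 -> m (a + 2 * size A).+1 = pr.2 ->
  stored m a (rcons A pr).
Proof.
elim: A a => /= [|pr' A IH] a.
  by rewrite muln0 addn0 => _ -> ->.
case=> -> -> st; rewrite (_ : a + _ = a.+2 + 2 * size A); last by lia.
by move=> e1 e2; split=> //; apply: IH.
Qed.

(** Shared by the copying and the printing phase: [i] sets are copied, [x] rows of the transpose are
    printed, and [A] holds the incidences stored so far. Scratch registers are left free. *)
Record invariant (V q p i x : nat) (A : seq (nat * nat)) (m : nat -> nat) : Prop :=
  Invariant {
  inv_one : m rOne = 1;
  inv_card : m rCard = q;
  inv_size : m rSize = p;
  inv_i : m rI = i;
  inv_x : m rX = x;
  inv_top : m rTop = base + 2 * size A;
  inv_stored : stored m base A;
  inv_small : [/\ q <= V, p <= V, base + 2 * size A <= V & i <= V];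
  inv_smallA : all (fun pr => (pr.1 <= V) && (pr.2 <= V)) A
}.


(** Registers lie below [base], so writing to them leaves the stored pairs intact. *)
Ltac keep_stored st :=
  let k := fresh in let lek := fresh in
  apply: eq_stored st => k /andP[lek _];
  cbv beta; do !(case: eqP => [?|_]; first lia); reflexivity.

Ltac exec_step eqs :=
  apply: HaltsStep; [reflexivity | rewrite /= /upd /= ?eqs /=; lia | ];
  rewrite /= /upd /= ?eqs /=.

Lemma copy_list V q p i x A m l w o n oo :
  invariant V q p i x A m -> m rLen = size l ->
  all (leq^~ V) l -> i < V -> base + 2 * (size A + size l) <= V ->
  (forall m', invariant V q p i.+1 x (A ++ [seq (y, i) | y <- l]) m' ->
     halts transpose_prog V (Config 12 m' w (o ++ l)) n oo) ->
  halts transpose_prog V (Config 17 m (l ++ w) o) (3 + 9 * size l + n) oo.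
Proof.
elim: l A m o => [|y l IH] A m o [m0 m1 m2 m3 m4 m5 st [leqV lepV leAV leiV] sA]
  /= mlen => [_|/andP[ley sl]] lti leAl K.
  do 3 exec_step (mlen, m0, m3).
  have := K (upd m rI (i + 1)); rewrite /= !cats0 /upd; apply.
  split=> //=; try lia.
  keep_stored st.
(* The two stores, at the top of the table and one cell further, hit no register. *)
have E r : r < base -> (r == base + 2 * size A) = false by lia.
have E1 r : r < base -> (r == base + 2 * size A + 1) = false by lia.
apply: (@halts_leq _ _ _ (9 + (3 + 9 * size l + n))); first lia.
do 3 exec_step (mlen, m0, m3, m5).
do 2 exec_step (mlen, m0, m3, m5, E 0 isT, E 3 isT, E 5 isT, E 6 isT, E 9 isT).
do 4 exec_step (mlen, m0, m3, m5, E 0 isT, E 3 isT, E 5 isT, E 6 isT, E 9 isT,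
                E1 0 isT, E1 5 isT, E1 6 isT).
apply: (IH (rcons A (y, i))) => //.
- split=> //=; rewrite ?size_rcons ?(E, E1) //; try lia.
  + apply: stored_rcons; last 2 first.
    * by do !case: eqP => [?|?] //; lia.
    * by do !case: eqP => [?|?] //; lia.
    by apply: eq_stored st => k /andP[lek ltk];
      do !(case: eqP => [?|_]; first lia).
  + by split=> //; lia.
  + by rewrite all_rcons /= ley leiV.
- by rewrite /= ?(E, E1) //=; lia.
- by rewrite size_rcons; lia.
- by move=> m'; rewrite !cat_rcons; apply: K.
Qed.

Fixpoint pairs (i : nat) (L : seq (seq nat)) : seq (nat * nat) :=
  if L is l :: L' then [seq (y, i) | y <- l] ++ pairs i.+1 L' else [::].

Definition encode_nats (L : seq (seq nat)) : seq nat :=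
  flatten [seq size l :: l | l <- L].

Lemma copy_lists V q p i x A m L o n oo :
  invariant V q p i x A m -> i + size L = p ->
  all (all (leq^~ V)) L -> base + 2 * (size A + total_size L) <= V ->
  (forall m', invariant V q p p x (A ++ pairs i L) m' ->
     halts transpose_prog V (Config 28 m' [::] (o ++ encode_nats L)) n oo) ->
  halts transpose_prog V (Config 12 m (encode_nats L) o)
    (3 + 7 * size L + 9 * total_size L + n) oo.
Proof.
rewrite /encode_nats /total_size.
elim: L i A m o => [|l L IH] i A m o inv /= => [ip _ _|ip /andP[sl sL] leA] K;
  case: (inv) => m0 m1 m2 m3 m4 m5 st [leqV lepV leAV leiV] sA.
  have tmp0 : p - i = 0 by lia.
  do 3 exec_step (m0, m2, m3, tmp0).
  rewrite /= !cats0 in K; apply: K; split=> //=; try lia.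
  keep_stored st.
apply: (@halts_leq _ _ _ (4 + (3 + 9 * size l +
  (3 + 7 * size L + 9 * sumn [seq size l | l <- L] + n)))); first lia.
have tmp1 : 0 < p - i by lia.
do 4 exec_step (m0, m2, m3, tmp1).
apply: (@copy_list _ q p i x A) => //=; try lia.
  split=> //=; try lia.
  keep_stored st.
move=> m' inv'; apply: (IH _ _ _ _ inv') => //.
- lia.
- by rewrite size_cat size_map; lia.
- by move=> m'' inv''; rewrite -catA cat_rcons; apply: K; rewrite catA.
Qed.

Definition column (A : seq (nat * nat)) (x : nat) : seq nat :=
  [seq pr.2 | pr <- A & pr.1 == x].

(** [B] is the part of the table still to be scanned and [a] its address; [cnt + size B] does not
    grow along the loop, which keeps the counter below [V]. A matching pair takes [11] steps, any
    other [9]. *)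
Lemma count_column V q p i x A m B a cnt o n oo :
  invariant V q p i x A m -> m rCnt = cnt -> m rPtr = a -> x <= V ->
  stored m a B -> base <= a -> a + 2 * size B = base + 2 * size A ->
  cnt + size B <= V -> all (fun pr => (pr.1 <= V) && (pr.2 <= V)) B ->
  (forall m', invariant V q p i x A m' ->
     m' rCnt = cnt + size (column B x) ->
     halts transpose_prog V (Config 45 m' [::] o) n oo) ->
  halts transpose_prog V (Config 33 m [::] o) (3 + 11 * size B + n) oo.
Proof.
rewrite /column.
elim: B a cnt m => [|[y z] B IH] a cnt m inv /= mcnt mptr lexV;
  case: (inv) => m0 m1 m2 m3 m4 m5 st [leqV lepV leAV leiV] sA.
  move=> _ lea aB _ _ K.
  have tmp0 : base + 2 * size A - a = 0 by lia.
  do 3 exec_step (m0, m5, mptr, tmp0).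
  apply: K; last by rewrite /= addn0.
  split=> //=.
  keep_stored st.
case=> ma ma1 stB lea aB lec /andP[/andP[leyV lezV] sB] K.
have tmp1 : 0 < base + 2 * size A - a by lia.
(* Register [11], that is [rTmp], is written before cell [a] is fetched. *)
have Ea : (a == 11) = false by lia.
apply: (@halts_leq _ _ _ (11 + (3 + 11 * size B + n))); first lia.
do 8 exec_step (m0, m5, mptr, m4, tmp1, Ea, ma).
(* Subtraction being truncated, [y - x + (x - y)] vanishes iff [y = x]. *)
case: eqP => [eyx|neyx] in K.
  have tmp0 : y - x + (x - y) = 0 by lia.
  do 3 exec_step (m0, m5, mptr, m4, tmp0, mcnt).
  apply: (IH a.+2 cnt.+1) => //=; try lia.
  - split=> //=.
    keep_stored st.
  - keep_stored stB.
  - by move=> m' inv' em'; apply: K => //=; rewrite em'; lia.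
have tmp2 : 0 < y - x + (x - y) by lia.
exec_step (m0, m5, mptr, m4, tmp2).
apply: (@halts_leq _ _ _ (3 + 11 * size B + n)); first lia.
apply: (IH a.+2 cnt) => //=; try lia.
- split=> //=.
  keep_stored st.
- keep_stored stB.
Qed.

Lemma print_column V q p i x A m B a o n oo :
  invariant V q p i x A m -> m rPtr = a -> x <= V ->
  stored m a B -> base <= a -> a + 2 * size B = base + 2 * size A ->
  all (fun pr => (pr.1 <= V) && (pr.2 <= V)) B ->
  (forall m', invariant V q p i x A m' ->
     halts transpose_prog V (Config 60 m' [::] (o ++ column B x)) n oo) ->
  halts transpose_prog V (Config 47 m [::] o) (3 + 12 * size B + n) oo.
Proof.
rewrite /column.
elim: B a m o => [|[y z] B IH] a m o inv /= mptr lexV;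
  case: (inv) => m0 m1 m2 m3 m4 m5 st [leqV lepV leAV leiV] sA.
  move=> _ lea aB _ K.
  have tmp0 : base + 2 * size A - a = 0 by lia.
  do 3 exec_step (m0, m5, mptr, tmp0).
  rewrite cats0 in K; apply: K; split=> //=.
  keep_stored st.
case=> ma ma1 stB lea aB /andP[/andP[leyV lezV] sB] K.
have tmp1 : 0 < base + 2 * size A - a by lia.
have Ea : (a == 11) = false by lia.
(* These three registers are written before the second component is fetched. *)
have [Ea1 Ea2 Ea3] : [/\ (a + 1 == 11) = false, (a + 1 == 9) = false &
                         (a + 1 == 7) = false] by split; lia.
have ma1' : m (a + 1) = z by rewrite addn1.
apply: (@halts_leq _ _ _ (12 + (3 + 12 * size B + n))); first lia.
do 9 exec_step (m0, m5, mptr, m4, tmp1, Ea, ma, Ea1, Ea2, Ea3, ma1').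
case: eqP => [eyx|neyx] in K.
  have tmp0 : y - x + (x - y) = 0 by lia.
  do 3 exec_step (m0, m5, mptr, m4, tmp0).
  apply: (IH a.+2) => //=; try lia.
  - split=> //=.
    keep_stored st.
  - keep_stored stB.
  - by move=> m' inv'; rewrite cat_rcons; apply: K.
have tmp2 : 0 < y - x + (x - y) by lia.
exec_step (m0, m5, mptr, m4, tmp2).
apply: (@halts_leq _ _ _ (3 + 12 * size B + n)); first lia.
apply: (IH a.+2) => //=; try lia.
- split=> //=.
  keep_stored st.
- keep_stored stB.
Qed.

(** For each [x], a stored pair costs [23 = 11 + 12] steps over the two scans, and the remaining
    control takes [14]. *)
Lemma print_columns V q p i x A m d o :
  invariant V q p i x A m -> x + d = q ->
  halts transpose_prog V (Config 28 m [::] o) (3 + (23 * size A + 14) * d)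
    (o ++ encode_nats [seq column A x' | x' <- iota x d]).
Proof.
rewrite /encode_nats.
elim: d x m o => [|d IH] x m o inv xd;
  case: (inv) => m0 m1 m2 m3 m4 m5 st [leqV lepV leAV leiV] sA.
  have tmp0 : q - x = 0 by lia.
  do 3 exec_step (m0, m1, m4, tmp0).
  by rewrite cats0; apply: HaltsEnd.
have tmp1 : 0 < q - x by lia.
apply: (@halts_leq _ _ _ (4 + (3 + 11 * size A + (2 + (3 + 12 * size A +
  (2 + (3 + (23 * size A + 14) * d))))))); first lia.
do 4 exec_step (m0, m1, m4, tmp1).
apply: (@count_column _ q p i x A _ A base 0) => //=; try lia.
- split=> //=.
  keep_stored st.
- keep_stored st.
move=> {inv m0 m1 m2 m3 m4 m5 st}m inv; rewrite add0n => mcnt.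
case: (inv) => m0 m1 m2 m3 m4 m5 st _ _.
have ltc : size (column A x) <= size A.
  by rewrite size_map size_filter count_size.
do 2 exec_step (m0, m1, m4, mcnt).
apply: (@print_column _ q p i x A _ A base) => //=; try lia.
- split=> //=.
  keep_stored st.
- keep_stored st.
move=> {inv m0 m1 m2 m3 m4 m5 st mcnt}m inv.
case: (inv) => m0 m1 m2 m3 m4 m5 st _ _.
do 2 exec_step (m0, m4).
have := IH x.+1; rewrite -cat_rcons catA; apply; last by lia.
split=> //=; first lia.
keep_stored st.
Qed.

Lemma transpose_prog_halts V q L :
  0 < q -> q <= V -> size L <= V -> all (all (leq^~ V)) L ->
  base + 2 * total_size L <= V ->
  halts transpose_prog V (init (q :: size L :: encode_nats L))
    (14 + 7 * size L + 9 * total_size L + (23 * total_size L + 14) * q)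
    ([:: size L; q; size L] ++ encode_nats L
       ++ encode_nats [seq column (pairs 0 L) x | x <- iota 0 q]).
Proof.
move=> q_gt0 leqV lepV sL leLV.
have sA i : size (pairs i L) = total_size L.
  by rewrite /total_size; elim: L i {sL lepV leLV} => //= l L IH i;
    rewrite size_cat size_map IH.
apply: (@halts_leq _ _ _ (8 + (3 + 7 * size L + 9 * total_size L +
  (3 + (23 * total_size L + 14) * q)))); first lia.
do 8 exec_step (q_gt0, leqnn).
apply: (@copy_lists _ q (size L) 0 0 [::]) => //=; try lia.
  by split=> //=; rewrite muln0 addn0; split=> //; lia.
by move=> m inv; rewrite -(sA 0); apply: (print_columns _ inv).
Qed.

Lemma transpose_prog_halts0 V p w : 0 < V -> p <= V ->
  halts transpose_prog V (init [:: 0, p & w]) 8 [:: 0; 0; 0].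
Proof.
move=> V0 leV; do 8 exec_step leqnn.
exact: HaltsEnd.
Qed.

(** * The printed numbers as encoded matrices *)

Lemma encode_listsE n (L : seq (seq 'I_n)) :
  encode_lists L = encode_nats [seq [seq val x | x <- l] | l <- L].
Proof.
rewrite /encode_lists /encode_nats -map_comp; congr flatten.
by apply: eq_map => l /=; rewrite size_map.
Qed.

(** Pairs are stored by increasing set index and a duplicate-free list meets [x] at most once, so
    the indices come out sorted and without repetition. The offset [i] serves the induction. *)
Lemma column_pairs L x i : all uniq L ->
  column (pairs i L) x =
  [seq k <- iota i (size L) | x \in nth [::] L (k - i)].
Proof.
elim: L i => //= l L IH i /andP[ul uL].
rewrite /column filter_cat map_cat -!/(column _ _) IH // subnn.
have -> : column [seq (y, i) | y <- l] x = nseq (x \in l) i.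
  rewrite /column -count_uniq_mem //.
  elim: l {ul} => //= y l IHl.
  by case: eqP => /= _; rewrite IHl.
have -> : [seq k <- iota i.+1 (size L) | x \in nth [::] L (k - i.+1)] =
          [seq k <- iota i.+1 (size L) | x \in nth [::] (l :: L) (k - i)].
  apply: eq_in_filter => k; rewrite mem_iota => /andP[ltk _].
  by rewrite -(subnSK ltk).
by case: (x \in l).
Qed.

Definition transpose_rows p q (L : seq (seq 'I_q)) : q.-tuple (seq 'I_p) :=
  [tuple [seq i : 'I_p <- enum 'I_p | x \in nth [::] L i] | x < q].

Lemma transpose_rows_uniq p q (L : seq (seq 'I_q)) :
  all uniq (transpose_rows p L).
Proof.
by apply/allP => _ /mapP[x _ ->]; rewrite filter_uniq ?enum_uniq.
Qed.

Lemma encode_transpose_rows q (L : seq (seq 'I_q)) : all uniq L ->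
  encode_lists (transpose_rows (size L) L) =
  encode_nats [seq column (pairs 0 [seq [seq val x | x <- l] | l <- L]) x
                 | x <- iota 0 q].
Proof.
move=> uL; rewrite encode_listsE; congr encode_nats.
rewrite -[in RHS]val_enum_ord /= -!map_comp; apply: eq_map => x /=.
rewrite column_pairs ?size_map; last first.
  rewrite all_map; apply: sub_all uL => l.
  by rewrite /= map_inj_uniq //; apply: val_inj.
rewrite -val_enum_ord filter_map; congr map; apply: eq_filter => i /=.
by rewrite subn0 (nth_map [::]) // mem_map //; apply: val_inj.
Qed.

(** * The reduction and the equality of outputs *)

Definition zmm_empty : zmm_instance :=
  @ZMMInstance 0 0 0 (@AdjMatrix 0 0 [tuple] isT) (@AdjMatrix 0 0 [tuple] isT).

Definition zmm_of_lists q (L : seq (seq 'I_q)) (uL : all uniq L) : zmm_instance :=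
  ZMMInstance (@AdjMatrix _ q (in_tuple L) uL)
    (AdjMatrix (transpose_rows_uniq (size L) L)).

Definition zmm_of_btds (R : realType) (c : R) (I : btds_instance c) : zmm_instance :=
  if btds_card I == 0 then zmm_empty else zmm_of_lists (btds_lists_uniq I).

(** A sum of nonnegative terms vanishes iff each term does. *)
Lemma zmm_output_of_lists q (L : seq (seq 'I_q)) (uL : all uniq L) :
  zmm_output (zmm_of_lists uL) =
  [exists i : 'I_(size L), exists j : 'I_(size L),
     [disjoint nth [::] L i & nth [::] L j]].
Proof.
apply: eq_existsb => i; apply: eq_existsb => j.
rewrite mxE psumr_eq0; last by move=> k _; rewrite !mxE mulr_ge0 // ler0n.
rewrite disjoint_has -all_predC.
apply/allP/allP => [H x xi|H x _] /=.
  have /= := H x (mem_index_enum x); rewrite !mxE !(tnth_nth [::]) /= xi mul1r.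
  rewrite (nth_map x) ?size_enum_ord // nth_ord_enum mem_filter mem_enum andbT.
  by rewrite pnatr_eq0 eqb0.
rewrite !mxE !(tnth_nth [::]) /=.
have [xi|] := boolP (x \in nth [::] L i); last by rewrite mul0r.
have := H x xi; rewrite /= mul1r.
rewrite (nth_map x) ?size_enum_ord // nth_ord_enum mem_filter mem_enum andbT.
by rewrite pnatr_eq0 eqb0.
Qed.

Lemma btds_outputE (R : realType) (c : R) (I : btds_instance c) :
  1 < size (btds_lists I) ->
  btds_output I =
  [exists i : 'I_(size (btds_lists I)), exists j : 'I_(size (btds_lists I)),
     [disjoint nth [::] (btds_lists I) i & nth [::] (btds_lists I) j]].
Proof.
rewrite /btds_output /btds_collection; move: (btds_sets_uniq I).
set L := btds_lists I; set S := map _ L => uS L_gt1.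
have nthS i : i < size L -> nth set0 S i = [set x in nth [::] L i].
  by move=> ltiL; rewrite (nth_map [::]).
have inS i : i < size L -> [set x in nth [::] L i] \in S.
  by move=> ltiL; rewrite -nthS // mem_nth ?size_map.
have disjS i j :
  [disjoint [set x in nth [::] L i] & [set x in nth [::] L j]] =
  [disjoint nth [::] L i & nth [::] L j].
  by apply: etrans (eq_disjoint _ _) (eq_disjoint_r _ _) => x; rewrite inE.
apply/exists_inP/existsP => [[C]|[i /existsP[j dij]]].
  rewrite inE => /(nthP set0)[i]; rewrite size_map => ltiL <-.
  case/exists_inP=> C'; rewrite inE => /(nthP set0)[j].
  rewrite size_map => ltjL <- /andP[_]; rewrite !nthS // => dij.
  by exists (Ordinal ltiL); apply/existsP; exists (Ordinal ltjL); rewrite -disjS.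
have neqS (k l : nat) : k < size L -> l < size L -> k != l ->
    [set x in nth [::] L k] != [set x in nth [::] L l].
  by move=> ltkL ltlL nkl; rewrite -!nthS // nth_uniq ?size_map.
have [eij|nij] := eqVneq i j; last first.
  exists [set x in nth [::] L i]; first by rewrite inE inS.
  apply/exists_inP; exists [set x in nth [::] L j]; first by rewrite inE inS.
  by rewrite neqS //= disjS.
(* A set disjoint from itself is empty, hence disjoint from every other set. *)
have Li0 : [set x in nth [::] L i] = set0.
  apply/setP=> x; rewrite !inE; apply/negP => xi.
  by move: dij; rewrite -eij => /pred0P/(_ x) /=; rewrite xi.
(* An index other than [i], in range because there are at least two sets. *)
pose k : nat := if i == 0 :> nat then 1 else 0.
have ltkL : k < size L by rewrite /k; case: ifP => // _; apply: ltnW.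
have nik : i != k :> nat by rewrite /k; case: (nat_of_ord i).
exists [set x in nth [::] L i]; first by rewrite inE inS.
apply/exists_inP; exists [set x in nth [::] L k]; first by rewrite inE inS.
by rewrite neqS //= Li0 disjoints_subset sub0set.
Qed.

(** * The ground set is polylogarithmic in the number of sets *)

Section PolylogCard.
Local Open Scope ring_scope.

Lemma log2_small (R : realType) n : (n <= 1)%N -> log2 n%:R = 0 :> R.
Proof. by case: n => [|[|]] // _; rewrite /log2 ?ln1 ?(ln0 (lexx _)) mul0r. Qed.

(** With at most one set the logarithm is [0] (by convention also for no set), and a real power of
    [0] is [0] or [1], so the strict bound leaves only an empty ground set. *)
Lemma btds_size_gt1 (R : realType) (c : R) (I : btds_instance c) :
  (0 < btds_card I)%N -> (1 < size (btds_lists I))%N.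
Proof.
move=> card_gt0; rewrite ltnNge; apply/negP => le1.
have := btds_big I; rewrite log2_small // ltNge => /negP; apply.
apply: (@le_trans _ _ 1); last by rewrite ler1n.
by rewrite /powR eqxx lern1 leq_b1.
Qed.

Lemma log2_le_trunc_log (R : realType) n : (0 < n)%N ->
  log2 n%:R <= (trunc_log 2 n).+1%:R :> R.
Proof.
move=> n_gt0; rewrite /log2 ler_pdivrMr ?ln_gt0 ?ltr1n //.
rewrite mulr_natl -lnXn ?ltr0n // ler_ln ?posrE ?ltr0n ?exprn_gt0 ?ltr0n //.
by rewrite -natrX ler_nat ltnW // trunc_log_ltn.
Qed.

Lemma btds_card_polylog (R : realType) (c : R) :
  exists k, forall I : btds_instance c,
    (btds_card I <= (trunc_log 2 (size (btds_lists I))).+1 ^ k)%N.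
Proof.
(* A natural exponent above [c]; it can replace [c] because the logarithm is at least [1] once there
   are two sets. *)
exists (Num.bound `|c|) => I.
have [c0|card_gt0] := posnP (btds_card I); first by rewrite {1}c0.
have L_gt1 := btds_size_gt1 card_gt0.
rewrite -(ler_nat R); apply: le_trans (ltW (btds_big I)) _.
have ge1 : 1 <= log2 (size (btds_lists I))%:R :> R.
  rewrite /log2 ler_pdivlMr ?ln_gt0 ?ltr1n // mul1r.
  by rewrite ler_ln ?posrE ?ltr0n ?ler_nat // ltnW.
have lec : c <= (Num.bound `|c|)%:R.
  by apply: le_trans (ler_norm _) (ltW (archi_boundP (normr_ge0 _))).
apply: le_trans (ler_powR ge1 lec) _.
rewrite powR_mulrn ?(le_trans ler01) // natrX.
rewrite lerXn2r ?nnegrE ?(le_trans ler01 ge1) ?ler0n //.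
by rewrite log2_le_trunc_log // ltnW.
Qed.

End PolylogCard.

Lemma zmm_of_btds_output (R : realType) (c : R) (I : btds_instance c) :
  btds_output I = zmm_output (zmm_of_btds I).
Proof.
rewrite /zmm_of_btds; case: posnP => [card0|card_gt0].
  apply/idP/existsP => [|[[]] //].
  (* Over an empty ground set any two sets coincide. *)
  case/exists_inP => C _ /exists_inP[C' _ /andP[/eqP[]]].
  by apply/setP => x; have := ltn_ord x; rewrite {2}card0.
by rewrite zmm_output_of_lists btds_outputE // btds_size_gt1.
Qed.

(** * Quasilinear running time *)

Definition time_bound (k n : nat) : nat :=
  37 * n.+1 * ((trunc_log 2 n).+1 ^ k).+1 * (2 * bitlen (16 + 2 * n)).

Lemma time_bound_quasilinear k : quasilinear (time_bound k).
Proof.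
(* The exponent is [k] for the size of the ground set plus one for the cost of a single step. *)
exists k.+1, (37 * 2 * (2 * 2 ^ k) * 8), 16 => n len; rewrite /time_bound.
set t := trunc_log 2 n.
have t_gt0 : 0 < t by apply: (@leq_trans 4); rewrite // (leq_trunc_log 2 len).
have leb : bitlen (16 + 2 * n) <= 4 * t.
  (* The bit length of [4 * n] is [t + 3], at most [4 * t]. *)
  have le4 : 16 + 2 * n <= 2 * (2 * n) by lia.
  apply: leq_trans (leq_bitlen le4) _.
  by rewrite /bitlen !mul2n !trunc_log2_double ?double_gt0; lia.
have let1 : (t.+1 ^ k).+1 <= 2 * 2 ^ k * t ^ k.
  have : t.+1 ^ k <= 2 ^ k * t ^ k.
    by rewrite -expnMn; case: (k) => // k'; rewrite leq_exp2r //; lia.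
  by have : 0 < 2 ^ k * t ^ k; rewrite ?muln_gt0 ?expn_gt0 ?t_gt0 //; lia.
have lenn : n.+1 <= 2 * n by lia.
apply: (leq_trans (leq_mul (leq_mul (leq_mul (leqnn 37) lenn) let1)
  (leq_mul (leqnn 2) leb))).
by rewrite expnS; lia.
Qed.

Lemma computes_zmm_of_btds (R : realType) (c : R) k :
  (forall I : btds_instance c,
    btds_card I <= (trunc_log 2 (size (btds_lists I))).+1 ^ k) ->
  forall I : btds_instance c,
    computes_within transpose_prog (btds_encode I) (zmm_encode (zmm_of_btds I))
      (time_bound k (btds_size I)).
Proof.
move=> polylog I; set n := btds_size I.
(* All operands stay below [16 + 2 * n]: the table starts at [base] and takes two cells per
   incidence. *)
suff [s les] : exists2 s, s <= 37 * n.+1 * ((trunc_log 2 n).+1 ^ k).+1 &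
    halts transpose_prog (16 + 2 * n) (init (btds_encode I)) s
      (zmm_encode (zmm_of_btds I)).
  case/halts_exec=> t let_ ex; exists t => //; apply: leq_trans let_ _.
  by rewrite leq_mul2r les orbT.
rewrite /zmm_of_btds /btds_encode; case: posnP => [card0|card_gt0].
  exists 8; first by rewrite -mulnA; nia.
  rewrite [X in init (X :: _)]card0.
  by apply: transpose_prog_halts0; rewrite /n /btds_size; lia.
set L := btds_lists I; set q := btds_card I.
pose L' := [seq [seq val x | x <- l] | l <- L].
have sL' : size L' = size L by rewrite size_map.
have tL' : total_size L' = total_size L.
  rewrite /total_size -map_comp; congr sumn.
  by apply: eq_map => l /=; rewrite size_map.
have nE : n = q + size L + total_size L by [].
rewrite encode_listsE -/L' -sL'.
exists (14 + 7 * size L' + 9 * total_size L' + (23 * total_size L' + 14) * q).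
  have leq_ : q <= (trunc_log 2 n).+1 ^ k.
    apply: leq_trans (polylog I) _.
    case: k {polylog} => // k; rewrite leq_exp2r // ltnS leq_trunc_log //.
    by rewrite nE addnAC leq_addl.
  move: leq_; set Q := _ ^ k => leQ.
  apply: (@leq_trans (37 * n.+1 * q.+1)); last by rewrite leq_mul2l ltnS leQ orbT.
  have : total_size L' * q <= n * q by rewrite leq_mul2r nE tL' leq_addl orbT.
  by rewrite sL' tL'; nia.
have -> : zmm_encode (zmm_of_lists (btds_lists_uniq I)) =
  [:: size L'; q; size L'] ++ encode_nats L' ++
  encode_nats [seq column (pairs 0 L') x | x <- iota 0 q].
  rewrite /zmm_encode /= encode_transpose_rows ?btds_lists_uniq //.
  by rewrite encode_listsE sL'.
apply: transpose_prog_halts; rewrite ?sL' ?tL' //; try lia.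
rewrite all_map; apply/allP => l _ /=; rewrite all_map; apply/allP => x _ /=.
by have := ltn_ord x; rewrite -/q; lia.
Qed.

Theorem theorem9 (R : realType) (c : R) :
  BigTwoDisjointSets c <=_ql ZerosMatrixMultiplication.
Proof.
exists (@zmm_of_btds R c); split; last exact: zmm_of_btds_output.
have [k polylog] := btds_card_polylog c.
exists transpose_prog, (time_bound k); split; first exact: time_bound_quasilinear.
exact: computes_zmm_of_btds polylog.
Qed.
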